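(* Let $f\colon X\to X$ be a continuous map on a compact metric space $X$, let $\mathcal X$ be an indexing set for a grid on $X$, and let $\mathcal F\colon\mathcal X\to2^{\mathcal X}$ be an outer approximation of $f$. Then the following maps form a commutative diagram of distributive lattices: - inclusions $\imath\colon\mathsf{Invset}^+(\mathcal X,\mathcal F)\to\mathsf{ASet}(\mathcal X,\mathcal F)$ and $\imath\colon\mathsf{Invset}^-(\mathcal X,\mathcal F)\to\mathsf{RSet}(\mathcal X,\mathcal F)$ (lattice monomorphisms); - $\boldsymbol\omega$ from $\mathsf{Invset}^+(\mathcal X,\mathcal F)$ and from $\mathsf{ASet}(\mathcal X,\mathcal F)$ to $\mathsf{Att}(\mathcal X,\mathcal F)$, and $\boldsymbol\alpha$ from $\mathsf{Invset}^-(\mathcal X,\mathcal F)$ and from $\mathsf{RSet}(\mathcal X,\mathcal F)$ to $\mathsf{Rep}(\mathcal X,\mathcal F)$ (lattice epimorphisms); - evaluation $|\cdot|\colon\mathsf{ASet}(\mathcal X,\mathcal F)\to\mathsf{ANbhd}_{\mathscr R}(X,f)$ and $|\cdot|\colon\mathsf{RSet}(\mathcal X,\mathcal F)\to\mathsf{RNbhd}_{\mathscr R}(X,f)$ (lattice monomorphisms); - $\omega=\omega(\cdot,f)\colon\mathsf{ANbhd}_{\mathscr R}(X,f)\to\mathsf{Att}(X,f)$ and $\alpha=\alpha(\cdot,f)\colon\mathsf{RNbhd}_{\mathscr R}(X,f)\to\mathsf{Rep}(X,f)$ (lattice epimorphisms); - $\omega(|\cdot|)\colon\mathsf{Att}(\mathcal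 X,\mathcal F)\to\mathsf{Att}(X,f)$ and $\alpha(|\cdot|)\colon\mathsf{Rep}(\mathcal X,\mathcal F)\to\mathsf{Rep}(X,f)$ (lattice homomorphisms); - the lattice anti-isomorphisms ${}^c\colon\mathsf{Invset}^+(\mathcal X,\mathcal F)\leftrightarrow\mathsf{Invset}^-(\mathcal X,\mathcal F)$, ${}^c\colon\mathsf{ASet}(\mathcal X,\mathcal F)\leftrightarrow\mathsf{RSet}(\mathcal X,\mathcal F)$, ${}^\#\colon\mathsf{ANbhd}_{\mathscr R}(X,f)\leftrightarrow\mathsf{RNbhd}_{\mathscr R}(X,f)$, and ${}^*\colon\mathsf{Att}(X,f)\leftrightarrow\mathsf{Rep}(X,f)$. Commutativity means: $\boldsymbol\omega\circ\imath=\boldsymbol\omega$ and $\boldsymbol\alpha\circ\imath=\boldsymbol\alpha$ on $\mathsf{Invset}^{+}$, $\mathsf{Invset}^-$; the inclusions intertwine the complement maps; $|\mathcal U^c|=|\mathcal U|^\#$ for $\mathcal U\in\mathsf{ASet}(\mathcal X,\mathcal F)$; $\alpha(U^\#,f)=\omega(U,f)^*$ for $U\in\mathsf{ANbhd}_{\mathscr R}(X,f)$; $\omega(|\boldsymbol\omega(\mathcal U)|,f)=\omega(|\mathcal U|,f)$ for $\mathcal U\in\mathsf{ASet}(\mathcal X,\mathcal F)$; and $\alpha(|\boldsymbol\alpha(\mathcal U)|,f)=\alpha(|\mathcal U|,f)$ for $\mathcal U\in\mathsf{RSet}(\mathcal X,\mathcal F)$.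
   Context: Lattices: all lattices are bounded; homomorphisms preserve $0$ and $1$; monomorphism/epimorphism means injective/surjective homomorphism; an anti-isomorphism is a bijection interchanging $\vee$ and $\wedge$. Regular closed sets: $S\subset X$ is regular closed if $S=\mathrm{cl}(\mathrm{int}(S))$. The family $\mathscr R(X)$ of regular closed sets is a Boolean algebra with $A\vee B=A\cup B$, $A\wedge B=\mathrm{cl}(\mathrm{int}(A\cap B))$, complement $A^\#=\mathrm{cl}(A^c)$, $0=\varnothing$, $1=X$. A grid on $X$ is a finite family of nonempty regular closed sets $\{|\xi| : \xi\in\mathcal X\}$, indexed by a finite set $\mathcal X$, with $\bigcup_\xi|\xi|=X$ and $|\xi|\cap\mathrm{int}|\xi'|=\varnothing$ for $\xi\ne\xi'$. For $\mathcal U\subset\mathcal X$, $|\mathcal U|=\bigcup_{\xi\in\mathcal U}|\xi|$, and $\mathcal U^c=\mathcal X\setminus\mathcal U$. Multivalued maps: a combinatorial multivalued map $\mathcal F$ on $\mathcal X$ assigns to each $\xi\in\mathcal X$ a subset $\mathcal F(\xi)\subset\mathcal X$; $\mathcal F(\mathcal U)=\bigcup_{\xi\in\mathcal U}\mathcal F(\xi)$; $\mathcal F^{-1}(\xi)=\{\eta : \xi\in\mathcal F(\eta)\}$; $\mathcal F^n$ is the $n$-fold composition ($\mathcal F^0=\mathrm{id}$), $\mathcal F^{-n}=(\mathcal F^{-1})^n$. $\boldsymbol\omega(\mathcal U)=\bigcap_{k\ge0}\bigcup_{n\ge k}\mathcal F^n(\mathcal U)$, $\boldsymbol\alpha(\mathcal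 U)=\bigcap_{k\le0}\bigcup_{n\le k}\mathcal F^n(\mathcal U)$. The following are lattices under $\cup,\cap$: $\mathsf{Invset}^\pm(\mathcal X,\mathcal F)=\{\mathcal U:\mathcal F^{\pm1}(\mathcal U)\subset\mathcal U\}$, $\mathsf{ASet}(\mathcal X,\mathcal F)=\{\mathcal U:\boldsymbol\omega(\mathcal U)\subset\mathcal U\}$, $\mathsf{RSet}(\mathcal X,\mathcal F)=\{\mathcal U:\boldsymbol\alpha(\mathcal U)\subset\mathcal U\}$. $\mathsf{Att}(\mathcal X,\mathcal F)=\{\mathcal A:\mathcal F(\mathcal A)=\mathcal A\}$ is a lattice with $\vee=\cup$, $\mathcal A\wedge\mathcal A'=\boldsymbol\omega(\mathcal A\cap\mathcal A')$; $\mathsf{Rep}(\mathcal X,\mathcal F)=\{\mathcal R:\mathcal F^{-1}(\mathcal R)=\mathcal R\}$ is a lattice with $\vee=\cup$, $\mathcal R\wedge\mathcal R'=\boldsymbol\alpha(\mathcal R\cap\mathcal R')$. $\mathcal F$ is an outer approximation of $f$ if $f(|\xi|)\subset\mathrm{int}|\mathcal F(\xi)|$ for all $\xi\in\mathcal X$. Continuous dynamics ($f$ need not be injective or surjective): $\omega(U,f)=\bigcap_{n\ge0}\mathrm{cl}\big(\bigcup_{k\ge n}f^k(U)\big)$ and $\alpha(U,f)=\bigcap_{n\ge0}\mathrm{cl}\big(\bigcup_{k\ge n}f^{-k}(U)\big)$, with $f^{-k}(U)=(f^k)^{-1}(U)$. $U$ is an attracting (repelling) neighborhood if $\omega(U,f)\subset\mathrm{int}(U)$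 (resp. $\alpha(U,f)\subset\mathrm{int}(U)$). $\mathsf{ANbhd}_{\mathscr R}(X,f)$ and $\mathsf{RNbhd}_{\mathscr R}(X,f)$ are the sets of regular closed attracting, resp. repelling, neighborhoods, with the operations $\vee,\wedge$ of $\mathscr R(X)$. Attractors (repellers) are the sets $\omega(U,f)$ with $U$ an attracting neighborhood (resp. $\alpha(U,f)$ with $U$ a repelling neighborhood). $\mathsf{Att}(X,f)$ has $\vee=\cup$, $A\wedge A'=\omega(A\cap A',f)$; $\mathsf{Rep}(X,f)$ has $\vee=\cup$, $\wedge=\cap$. For an attractor $A$, its dual repeller is $A^*=\{x\in X:\omega(\{x\},f)\cap A=\varnothing\}$, which equals $\alpha(X\setminus U,f)$ for any attracting neighborhood $U$ with $\omega(U,f)=A$; the inverse map $R\mapsto R^*$ is $R^*=\omega(X\setminus V,f)$ for any repelling neighborhood $V$ with $\alpha(V,f)=R$. *)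

(* Defs.v *)
From mathcomp Require Import all_boot all_order all_algebra.
From mathcomp Require Import all_classical all_reals all_analysis.

Set Implicit Arguments.
Unset Strict Implicit.
Unset Printing Implicit Defensive.

Local Open Scope classical_set_scope.

(** * Bounded lattices carried by a subset of a type *)

(* Raw data only: that the operations preserve the carrier and satisfy the
   laws is asserted by [bounded_distributive_lattice]. *)
Record set_lattice (T : Type) := SetLattice {
  carrier : set T;
  join : T -> T -> T;
  meet : T -> T -> T;
  bot : T;
  top : T }.

Record bounded_distributive_lattice (T : Type) (L : set_lattice T) : Prop := {
  bdl_join : forall x y, carrier L x -> carrier L y -> carrier L (join L x y);
  bdl_meet : forall x y, carrier L x -> carrier L y -> carrier L (meet L x y);
  bdl_bot : carrier L (bot L);
  bdl_top : carrier L (top L);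
  bdl_joinC : forall x y, carrier L x -> carrier L y ->
    join L x y = join L y x;
  bdl_meetC : forall x y, carrier L x -> carrier L y ->
    meet L x y = meet L y x;
  bdl_joinA : forall x y z, carrier L x -> carrier L y -> carrier L z ->
    join L x (join L y z) = join L (join L x y) z;
  bdl_meetA : forall x y z, carrier L x -> carrier L y -> carrier L z ->
    meet L x (meet L y z) = meet L (meet L x y) z;
  bdl_joinK : forall x y, carrier L x -> carrier L y ->
    meet L x (join L x y) = x;
  bdl_meetK : forall x y, carrier L x -> carrier L y ->
    join L x (meet L x y) = x;
  bdl_meetUl : forall x y z, carrier L x -> carrier L y -> carrier L z ->
    meet L (join L x y) z = join L (meet L x z) (meet L y z);
  bdl_join0 : forall x, carrier L x -> join L (bot L) x = x;
  bdl_meet1 : forall x, carrier L x -> meet L (top L) x = x }.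

Record lattice_hom (T T' : Type) (L : set_lattice T) (M : set_lattice T')
    (g : T -> T') : Prop := {
  hom_fun : set_fun (carrier L) (carrier M) g;
  hom_join : forall x y, carrier L x -> carrier L y ->
    g (join L x y) = join M (g x) (g y);
  hom_meet : forall x y, carrier L x -> carrier L y ->
    g (meet L x y) = meet M (g x) (g y);
  hom_bot : g (bot L) = bot M;
  hom_top : g (top L) = top M }.

Definition lattice_mono (T T' : Type) (L : set_lattice T) (M : set_lattice T')
  (g : T -> T') := lattice_hom L M g /\ set_inj (carrier L) g.

Definition lattice_epi (T T' : Type) (L : set_lattice T) (M : set_lattice T')
  (g : T -> T') := lattice_hom L M g /\ set_surj (carrier L) (carrier M) g.

(* The lattices below are distinct structures on subsets of one type, so an
   inclusion between carriers is the identity of that type; that it maps the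
   first carrier into the second is part of [lattice_hom]. *)
Definition inclusion (T : Type) (x : T) : T := x.

Record lattice_anti_iso (T T' : Type) (L : set_lattice T) (M : set_lattice T')
    (g : T -> T') : Prop := {
  anti_bij : set_bij (carrier L) (carrier M) g;
  anti_join : forall x y, carrier L x -> carrier L y ->
    g (join L x y) = meet M (g x) (g y);
  anti_meet : forall x y, carrier L x -> carrier L y ->
    g (meet L x y) = join M (g x) (g y) }.

Definition lattice_anti_iso_pair (T T' : Type)
    (L : set_lattice T) (M : set_lattice T') (g : T -> T') (h : T' -> T) :=
  [/\ lattice_anti_iso L M g, lattice_anti_iso M L h,
      forall x, carrier L x -> h (g x) = x &
      forall y, carrier M y -> g (h y) = y].

(** * Combinatorial multivalued maps *)

Section Combinatorial.
Variable E : finType.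
Implicit Types (F G : E -> set E) (U : set E).

Definition mv_image F U : set E := \bigcup_(xi in U) F xi.

Definition mv_inv F : E -> set E := fun xi => [set eta | F eta xi].

Definition mv_comp G F : E -> set E := fun xi => mv_image G (F xi).

Definition mv_pow F (n : nat) : E -> set E :=
  iter n (mv_comp F) (fun xi => [set xi]).

Definition mv_omega F U : set E :=
  \bigcap_k \bigcup_(n in [set n | (k <= n)%N]) mv_image (mv_pow F n) U.

(* The indices k, n <= 0 are replaced by their opposites, and
   F^(-n) = (F^-1)^n. *)
Definition mv_alpha F U : set E :=
  \bigcap_k \bigcup_(n in [set n | (k <= n)%N])
    mv_image (mv_pow (mv_inv F) n) U.

Definition Invset_plus F : set_lattice (set E) :=
  SetLattice [set U | mv_image F U `<=` U] setU setI set0 setT.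

Definition Invset_minus F : set_lattice (set E) :=
  SetLattice [set U | mv_image (mv_inv F) U `<=` U] setU setI set0 setT.

Definition ASet F : set_lattice (set E) :=
  SetLattice [set U | mv_omega F U `<=` U] setU setI set0 setT.

Definition RSet F : set_lattice (set E) :=
  SetLattice [set U | mv_alpha F U `<=` U] setU setI set0 setT.

Definition mvAtt F : set_lattice (set E) :=
  SetLattice [set A | mv_image F A = A]
    setU (fun A B => mv_omega F (A `&` B)) set0 (mv_omega F setT).

Definition mvRep F : set_lattice (set E) :=
  SetLattice [set A | mv_image (mv_inv F) A = A]
    setU (fun A B => mv_alpha F (A `&` B)) set0 (mv_alpha F setT).

End Combinatorial.

(** * Regular closed sets, grids and continuous dynamics *)

Section Dynamics.
Variable X : topologicalType.
Implicit Types (f : X -> X) (U V A B : set X).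

Definition regclosed_meet A B : set X := closure (A `&` B)°.

Definition regclosed_compl A : set X := closure (~` A).

Record is_grid (E : finType) (cell : E -> set X) : Prop := {
  grid_nonempty : forall xi, cell xi !=set0;
  grid_regclosed : forall xi, regclosed (cell xi);
  grid_cover : \bigcup_xi cell xi = [set: X];
  grid_disjoint : forall xi xi', xi != xi' ->
    cell xi `&` (cell xi')° = set0 }.

Definition geval (E : finType) (cell : E -> set X) (U : set E) : set X :=
  \bigcup_(xi in U) cell xi.

Definition outer_approximation f (E : finType) (cell : E -> set X)
    (F : E -> set E) : Prop :=
  forall xi, f @` cell xi `<=` (geval cell (F xi))°.

Definition omega f U : set X :=
  \bigcap_n closure (\bigcup_(k in [set k | (n <= k)%N]) iter k f @` U).

Definition alpha f U : set X :=
  \bigcap_n closure (\bigcup_(k in [set k | (n <= k)%N]) iter k f @^-1` U).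

Definition attracting_nbhd f U : Prop := omega f U `<=` U°.

Definition repelling_nbhd f U : Prop := alpha f U `<=` U°.

Definition ANbhd f : set_lattice (set X) :=
  SetLattice [set U | regclosed U /\ attracting_nbhd f U]
    setU regclosed_meet set0 setT.

Definition RNbhd f : set_lattice (set X) :=
  SetLattice [set U | regclosed U /\ repelling_nbhd f U]
    setU regclosed_meet set0 setT.

Definition Att f : set_lattice (set X) :=
  SetLattice [set A | exists2 U, attracting_nbhd f U & A = omega f U]
    setU (fun A B => omega f (A `&` B)) set0 (omega f setT).

Definition Rep f : set_lattice (set X) :=
  SetLattice [set A | exists2 U, repelling_nbhd f U & A = alpha f U]
    setU setI set0 setT.

Definition dual_repeller f A : set X :=
  [set x | omega f [set x] `&` A = set0].

(* omega f (~` V) for some repelling neighborhood V with alpha f V = B; for a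
   continuous f on a compact metric space it does not depend on V.  When B is
   not a repeller, [xget] returns set0 and the value is irrelevant. *)
Definition dual_attractor f B : set X :=
  omega f (~` xget set0 [set V | repelling_nbhd f V /\ alpha f V = B]).

End Dynamics.

(* Main.v *)
Require Import Defs.
From mathcomp Require Import all_boot all_order all_algebra.
From mathcomp Require Import all_classical all_reals all_analysis.

(** On both sides of the diagram the attractors are fixed points of a limit
    operator [w] that is monotone, idempotent and additive: [mv_omega F] on
    sets of indices, [omega f] on subsets of [X]. For a monotone idempotent
    operator, any set between [w A] and [A] has the same limit as [A]
    ([core_squeeze]), and this alone gives the lattice laws, with meet [w (A
    `&` B)] ([core_lattice]), and the compatibility of [w] with meets of
    neighborhoods ([core_meet]). The lattice of regular closed sets is a third
    instance, for the operator that maps a set to the closure of its interior,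
    which is additive on closed sets.

    Combinatorially, everything follows from the pigeonhole principle on a
    finite set ([finite_infinitely_often]), and the repelling half is the
    attracting half for the inverse multivalued map.

    Topologically there is no such symmetry, since [f] need not be invertible.
    Compactness gives the invariance [f @` omega f U = omega f U]
    ([omega_image]), hence idempotence. For a repelling neighborhood [U], the
    set [alpha f U] is simply the set of points whose orbit stays in [U]
    ([alpha_stay]), so that intersections of repellers are immediate. The
    complement of an attracting neighborhood is repelling ([attracting_setC]),
    and the repeller obtained is the dual one ([dual_repeller_omega]). The
    complement of a repelling neighborhood need not be attracting, but it can
    be enlarged to an attracting one with the same limit ([repelling_dual]).
    Together with [dual_repeller_inj] this makes the duality between attractors
    and repellers a bijection, independent of the neighborhoods used.

    The two sides meet in the evaluation of a set of indices on the grid: the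
    interior of a union of cells is the complement of the union of the other
    cells ([interior_geval]), so evaluation turns complements and intersections
    into the operations on regular closed sets. An outer approximation forces
    the limit set of [geval cell U] into the interior of the cells of [mv_omega
    F U] ([omega_geval_interior]); therefore evaluation preserves attracting
    neighborhoods, and those of [U] and of [mv_omega F U] have the same
    attractor. The repelling statements follow by complements and by
    [alpha_stay]. *)

Set Implicit Arguments.
Unset Strict Implicit.
Unset Printing Implicit Defensive.

Local Open Scope classical_set_scope.

(** * Lattices carried by sets *)

Section Transfer.
Variables (T T' T'' : Type).
Variables (L : set_lattice T) (M : set_lattice T') (N : set_lattice T'').

(** A bijection that turns joins into meets and meets into joins has an inverse
    that does the same, so only one of the two maps has to be examined. *)
Lemma anti_iso_pair g h :
    (forall x y, carrier L x -> carrier L y -> carrier L (join L x y)) ->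
    (forall x y, carrier L x -> carrier L y -> carrier L (meet L x y)) ->
    set_fun (carrier L) (carrier M) g -> set_fun (carrier M) (carrier L) h ->
    (forall x, carrier L x -> h (g x) = x) ->
    (forall y, carrier M y -> g (h y) = y) ->
    (forall x y, carrier L x -> carrier L y ->
      g (join L x y) = meet M (g x) (g y)) ->
    (forall x y, carrier L x -> carrier L y ->
      g (meet L x y) = join M (g x) (g y)) ->
  lattice_anti_iso_pair L M g h.
Proof.
move=> LU LI gM hL hg gh gU gI; split=> //; split=> //.
- split=> //.
  + by move=> x y /set_mem Lx /set_mem Ly e; rewrite -(hg x)// -(hg y)// e.
  + by move=> y My; exists (h y); [exact: hL|exact: gh].
- split=> //.
  + by move=> x y /set_mem Lx /set_mem Ly e; rewrite -(gh x)// -(gh y)// e.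
  + by move=> y My; exists (g y); [exact: gM|exact: hg].
- by move=> x y Mx My; rewrite -{1}(gh x)// -{1}(gh y)// -gI ?hg//;
    [apply: LI|..]; exact: hL.
- by move=> x y Mx My; rewrite -{1}(gh x)// -{1}(gh y)// -gU ?hg//;
    [apply: LU|..]; exact: hL.
Qed.

Lemma lattice_hom_comp g h :
  lattice_hom L M g -> lattice_hom M N h -> lattice_hom L N (h \o g).
Proof.
move=> gP hP; split=> [x Lx|x y Lx Ly|x y Lx Ly||] /=.
- by apply: (hom_fun hP); exact: (hom_fun gP).
- by rewrite (hom_join gP)// (hom_join hP)//; exact: (hom_fun gP).
- by rewrite (hom_meet gP)// (hom_meet hP)//; exact: (hom_fun gP).
- by rewrite (hom_bot gP) (hom_bot hP).
- by rewrite (hom_top gP) (hom_top hP).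
Qed.

(** This is how a map is obtained on the combinatorial attractors: their meet
    is awkward, but they are a quotient of a lattice in which it is a plain
    intersection, and a homomorphism constant on the fibres descends. *)
Lemma lattice_hom_factor e q g :
    bounded_distributive_lattice L -> lattice_epi L M e -> lattice_hom L N q ->
    (forall x, carrier L x -> g (e x) = q x) -> lattice_hom M N g.
Proof.
move=> LP [eh es] qh ge; split.
- by move=> _ /es[x Lx <-]; rewrite ge//; exact: (hom_fun qh).
- move=> _ _ /es[x Lx <-] /es[y Ly <-].
  by rewrite -(hom_join eh)// !ge ?(hom_join qh)//; exact: bdl_join.
- move=> _ _ /es[x Lx <-] /es[y Ly <-].
  by rewrite -(hom_meet eh)// !ge ?(hom_meet qh)//; exact: bdl_meet.
- by rewrite -(hom_bot eh) ge ?(hom_bot qh)//; exact: bdl_bot.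
- by rewrite -(hom_top eh) ge ?(hom_top qh)//; exact: bdl_top.
Qed.
End Transfer.

Section LatticesOfSets.
Variable T : Type.
Implicit Types (A B P U V : set T) (C : set (set T)) (w : set T -> set T).

Lemma set_ring_lattice C : setU_closed C -> setI_closed C -> C set0 ->
  C setT -> bounded_distributive_lattice (SetLattice C setU setI set0 setT).
Proof.
move=> CU CI C0 CT; split=> //=.
- by move=> x y _ _; rewrite setUC.
- by move=> x y _ _; rewrite setIC.
- by move=> x y z _ _ _; rewrite setUA.
- by move=> x y z _ _ _; rewrite setIA.
- by move=> x y _ _; apply: setIidl => t; left.
- by move=> x y _ _; apply: setUidl => t [].
- by move=> x y z _ _ _; rewrite setIUl.
- by move=> x _; rewrite set0U.
- by move=> x _; rewrite setTI.
Qed.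

Lemma setC_anti_iso_pair C C' : setU_closed C -> setI_closed C ->
    (forall U, C U -> C' (~` U)) -> (forall U, C' U -> C (~` U)) ->
  lattice_anti_iso_pair (SetLattice C setU setI set0 setT)
    (SetLattice C' setU setI set0 setT) setC setC.
Proof.
move=> CU CI CC' C'C; apply: anti_iso_pair => // [U _|U _|U V _ _|U V _ _].
- exact: setCK.
- exact: setCK.
- exact: setCU.
- exact: setCI.
Qed.

(** The common shape of the omega-limit operators and of regularization. Unlike
    for the kernel operators of order theory, [w A] need not be contained in
    [A]. *)
Record core_operator w : Prop := {
  core_mono : forall A B, A `<=` B -> w A `<=` w B;
  core_idem : forall A, w (w A) = w A }.

Section Core.
Variables (w : set T -> set T) (wP : core_operator w).

(** Every set squeezed between the core of [A] and [A] has the same core.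
    Nearly all identities between limit sets below are instances of this. *)
Lemma core_squeeze A B : w A `<=` B -> B `<=` A -> w B = w A.
Proof.
move=> wAB BA; apply/seteqP; split; first exact: core_mono wP _ _ BA.
by rewrite -(core_idem wP A); apply: core_mono wP _ _ wAB.
Qed.

Lemma core_meet P U V : w U `&` w V `<=` P -> P `<=` U `&` V ->
  w P = w (w U `&` w V).
Proof.
move=> wP_P PUV; apply/esym/core_squeeze => //.
by rewrite subsetI; split; apply: (core_mono wP) => x /PUV[].
Qed.

(** For fixed points [x] and [y], the core of their intersection lies in both,
    so it may replace the intersection inside a further core: nested meets are
    cores of plain intersections, and the lattice laws reduce to those of sets. *)
Lemma core_lattice C : C `<=` [set A | w A = A] -> setU_closed C ->
    (forall A B, C A -> C B -> C (w (A `&` B))) -> C set0 -> C (w setT) ->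
    (forall A B D, C A -> C B -> C D ->
      w (A `&` D `|` B `&` D) = w (A `&` D) `|` w (B `&` D)) ->
  bounded_distributive_lattice
    (SetLattice C setU (fun A B => w (A `&` B)) set0 (w setT)).
Proof.
move=> Cw CU CI C0 CT wU.
have subw x P : C x -> P `<=` x -> w P `<=` x.
  by move=> /Cw /= <-; rewrite -{2}core_idem//; exact: core_mono.
have meetA x y z : C x -> C y -> C z ->
    w (x `&` w (y `&` z)) = w (x `&` (y `&` z)).
  move=> Cx Cy Cz; apply: core_squeeze => //.
    rewrite subsetI; split; first by apply: subw => // t [].
    by apply: core_mono => // t [].
  by apply: setIS; rewrite subsetI; split; apply: subw => // t [].
split=> //=.
- by move=> x y _ _; rewrite setUC.
- by move=> x y _ _; rewrite setIC.
- by move=> x y z _ _ _; rewrite setUA.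
- move=> x y z Cx Cy Cz; rewrite meetA// (setIC (w _)) meetA//.
  by congr w; rewrite setIA setIC.
- by move=> x y /Cw /= wx _; rewrite setIidl// => t; left.
- by move=> x y Cx _; apply: setUidl; apply: subw => // t [].
- by move=> x y z Cx Cy Cz; rewrite setIUl wU.
- by move=> x _; rewrite set0U.
- move=> x /Cw /= wx; rewrite setIC setIidl// -{1}wx; exact: (core_mono wP).
Qed.
End Core.
End LatticesOfSets.

(** * Combinatorial limit sets *)

Section Combinatorial.
Variable E : finType.
Implicit Types (F : E -> set E) (U V A : set E).

(** The pigeonhole principle: infinitely many times share finitely many
    possible witnesses. It plays the part that compactness plays for [omega f]. *)
Lemma finite_infinitely_often (P : nat -> E -> Prop) :
  (forall k, exists2 n, (k <= n)%N & exists y, P n y) ->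
  exists y, forall k, exists2 n, (k <= n)%N & P n y.
Proof.
move=> io; apply: contrapT => /forallNP nP.
have /choice[b bP] (y : E) : exists k, forall n, (k <= n)%N -> ~ P n y.
  have /existsNP[k nk] := nP y; exists k => n kn Pn.
  by apply: nk; exists n.
have [n bn [y Py]] := io (\max_y b y).
by apply: (bP y n) => //; apply: leq_trans bn; exact: leq_bigmax.
Qed.

Lemma mv_omegaP F U y : mv_omega F U y <->
  forall k, exists2 n, (k <= n)%N & exists2 x, U x & mv_pow F n x y.
Proof.
split=> [Uy k|Uy k _].
  by have [n kn [x Ux xy]] := Uy k I; exists n => //; exists x.
by have [n kn [x Ux xy]] := Uy k; exists n => //; exists x.
Qed.

Lemma mv_powSr F n x y :
  mv_pow F n.+1 x y <-> exists2 z, F x z & mv_pow F n z y.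
Proof.
elim: n y => [|n IHn] y.
  by split=> [[_ -> xy]|[z xz ->]]; [exists y|exists x].
split=> [[z /IHn[t xt tz] zy]|[t xt [z tz zy]]].
  by exists t => //; exists z.
by exists z => //; apply/IHn; exists t.
Qed.

Lemma mv_pow_inv F n x y : mv_pow (mv_inv F) n x y <-> mv_pow F n y x.
Proof.
elim: n x y => [|n IHn] x y; first by split=> ->.
by split=> [[z /IHn zx yz]|/mv_powSr[z yz zx]];
  [apply/mv_powSr|]; exists z => //; exact/IHn.
Qed.

(** A limit element has a predecessor at infinitely many times, and by the
    pigeonhole principle one of these predecessors is itself a limit element. *)
Lemma mv_omega_fixed F U : mv_image F (mv_omega F U) = mv_omega F U.
Proof.
apply/seteqP; split=> [y [z /mv_omegaP zU zy]|y /mv_omegaP yU].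
  apply/mv_omegaP => k; have [n kn [x Ux xz]] := zU k.
  by exists n.+1; [exact: leqW|exists x => //; exists z].
have [|z zP] := @finite_infinitely_often
    (fun n z => F z y /\ exists2 x, U x & mv_pow F n x z).
  move=> k; have [[//|n] kn [x Ux [z xz zy]]] := yU k.+1.
  by exists n => //; exists z; split=> //; exists x.
exists z; last by have [n _ []] := zP 0%N.
by apply/mv_omegaP => k; have [n kn []] := zP k; exists n.
Qed.

Lemma mv_pow_fixed F A n : mv_image F A = A -> mv_image (mv_pow F n) A = A.
Proof.
move=> FA; elim: n => [|n IHn].
  by apply/seteqP; split=> [y [x Ax ->]|y Ay] //; exists y.
rewrite -[RHS]FA -[in RHS]IHn; apply/seteqP; split=> y.
  by move=> [x Ax [z xz zy]]; exists z => //; exists x.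
by move=> [z [x Ax xz] zy]; exists x => //; exists z.
Qed.

Lemma mv_omega_id F A : mv_image F A = A -> mv_omega F A = A.
Proof.
move=> FA; apply/seteqP; split=> [y /mv_omegaP/(_ 0%N)[n _]|y Ay].
  by move=> yn; rewrite -(mv_pow_fixed n FA).
by apply/mv_omegaP => k; exists k => //; rewrite -(mv_pow_fixed k FA) in Ay.
Qed.

Lemma mv_omega_core F : core_operator (mv_omega F).
Proof.
have mono A B : A `<=` B -> mv_omega F A `<=` mv_omega F B.
  move=> AB y /mv_omegaP yA; apply/mv_omegaP => k.
  by have [n kn [x /AB Bx xy]] := yA k; exists n => //; exists x.
split=> // A; exact/mv_omega_id/mv_omega_fixed.
Qed.

Lemma mv_omegaU F A B : mv_omega F (A `|` B) = mv_omega F A `|` mv_omega F B.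
Proof.
apply/seteqP; split; last first.
  by rewrite subUset; split; apply: (core_mono (mv_omega_core F)) => x;
    [left|right].
move=> y /mv_omegaP yAB; apply: contrapT => /not_orP[nA nB].
move/mv_omegaP/existsNP: nA => [k nk]; move/mv_omegaP/existsNP: nB => [m nm].
have [n kmn [x [Ax|Bx] xy]] := yAB (maxn k m).
  by apply: nk; exists n; [rewrite (leq_trans _ kmn)// leq_maxl|exists x].
by apply: nm; exists n; [rewrite (leq_trans _ kmn)// leq_maxr|exists x].
Qed.

(** Uniformity in time: if elements outside the limit were reached at
    arbitrarily late times, one of them would be reached infinitely often. *)
Lemma mv_omega_absorbs F U : exists K, forall n x y,
  (K <= n)%N -> U x -> mv_pow F n x y -> mv_omega F U y.
Proof.
apply: contrapT => /forallNP nK.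
have [|y yP] := @finite_infinitely_often
  (fun n y => (exists2 x, U x & mv_pow F n x y) /\ ~ mv_omega F U y).
  move=> k; have := nK k; move=> /existsNP[n] /existsNP[x] /existsNP[y].
  move=> /not_implyP[kn] /not_implyP[Ux] /not_implyP[xy nUy].
  by exists n => //; exists y; split=> //; exists x.
have [_ _ [_]] := yP 0%N; apply; apply/mv_omegaP => k.
by have [n kn []] := yP k; exists n.
Qed.

Lemma Invset_lattice F : bounded_distributive_lattice (Invset_plus F).
Proof.
apply: set_ring_lattice => [A B FA FB|A B FA FB|y [x]//|//] y [x].
  by move=> [Ax|Bx] xy; [left; apply: FA|right; apply: FB]; exists x.
by move=> [Ax Bx] xy; split; [apply: FA|apply: FB]; exists x.
Qed.

Lemma ASet_lattice F : bounded_distributive_lattice (ASet F).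
Proof.
have wP := mv_omega_core F.
apply: set_ring_lattice => [A B FA FB|A B FA FB||//] /=.
- by rewrite mv_omegaU; exact: setUSS.
- by rewrite subsetI; split; [apply: subset_trans FA|apply: subset_trans FB];
    apply: (core_mono wP) => x [].
- by move=> y /mv_omegaP/(_ 0%N)[n _ []].
Qed.

Lemma mvAtt_lattice F : bounded_distributive_lattice (mvAtt F).
Proof.
apply: core_lattice (mv_omega_core F) _ _ _ _ _ _ _
  => [A /mv_omega_id//|A B||||A B D _ _ _].
- by move=> /= FA FB; rewrite /mv_image bigcup_setU -/(mv_image F A)
    -/(mv_image F B) FA FB.
- by move=> A B _ _; exact: mv_omega_fixed.
- by rewrite /= /mv_image bigcup_set0.
- exact: mv_omega_fixed.
- exact: mv_omegaU.
Qed.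

Lemma Invset_sub_ASet F U : carrier (Invset_plus F) U -> carrier (ASet F) U.
Proof.
move=> FU y /mv_omegaP/(_ 0%N)[n _ [x Ux]].
elim: n y => [y ->//|n IHn y [z /IHn Uz zy]].
by apply: FU; exists z.
Qed.

Lemma Invset_ASet_mono F :
  lattice_mono (Invset_plus F) (ASet F) (@inclusion _).
Proof. by split=> //; split=> // U; exact: Invset_sub_ASet. Qed.

Lemma mv_omega_ASet_epi F : lattice_epi (ASet F) (mvAtt F) (mv_omega F).
Proof.
split; last first.
  by move=> A /= FA; exists A; [rewrite /= mv_omega_id|exact: mv_omega_id].
split=> //= [U _|U V _ _|U V AU AV|].
- exact: mv_omega_fixed.
- exact: mv_omegaU.
- by apply: (core_meet (mv_omega_core F)) => // x [/AU ? /AV].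
- by apply: mv_omega_id; rewrite /mv_image bigcup_set0.
Qed.

Lemma mv_omega_Invset_epi F :
  lattice_epi (Invset_plus F) (mvAtt F) (mv_omega F).
Proof.
split; last first.
  by move=> A /= FA; exists A; [rewrite /= FA|exact: mv_omega_id].
exact: lattice_hom_comp (Invset_ASet_mono F).1 (mv_omega_ASet_epi F).1.
Qed.

Lemma Invset_setC F U :
  carrier (Invset_plus F) U -> carrier (Invset_minus F) (~` U).
Proof. by move=> FU y [x nUx yx] Uy; apply: nUx; apply: FU; exists y. Qed.

Lemma Invset_compl F :
  lattice_anti_iso_pair (Invset_plus F) (Invset_minus F) setC setC.
Proof.
apply: setC_anti_iso_pair.
- exact: bdl_join (Invset_lattice F).
- exact: bdl_meet (Invset_lattice F).
- exact: Invset_setC.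
- exact: (@Invset_setC (mv_inv F)).
Qed.

(** A backward limit of the complement that lies in [U] would reach some fixed
    [y] outside [U] infinitely often, so [y] would be in the forward limit of
    [U]. *)
Lemma RSet_setC F U : carrier (ASet F) U -> carrier (RSet F) (~` U).
Proof.
move=> AU x /mv_omegaP xU Ux.
have [|y yP] := @finite_infinitely_often (fun n y => ~ U y /\ mv_pow F n x y).
  move=> k; have [n kn [y nUy /mv_pow_inv xy]] := xU k.
  by exists n => //; exists y.
have [_ _ [nUy _]] := yP 0%N; apply/nUy/AU/mv_omegaP => k.
by have [n kn [_ xy]] := yP k; exists n => //; exists x.
Qed.

(** Inverting a multivalued map twice gives it back by computation, and the
    repelling notions are the attracting ones of the inverse map. *)
Lemma ASet_setC F U : carrier (RSet F) U -> carrier (ASet F) (~` U).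
Proof. exact: (@RSet_setC (mv_inv F)). Qed.

Lemma ASet_compl F : lattice_anti_iso_pair (ASet F) (RSet F) setC setC.
Proof.
apply: setC_anti_iso_pair.
- exact: bdl_join (ASet_lattice F).
- exact: bdl_meet (ASet_lattice F).
- exact: RSet_setC.
- exact: ASet_setC.
Qed.

End Combinatorial.

(** * Limit sets of a continuous map *)

Section Topology.
Variable X : topologicalType.
Implicit Types (A B C U V W : set X) (S : nat -> set X).

Lemma closure_sub A C : closed C -> A `<=` C -> closure A `<=` C.
Proof. by move=> cC AC; apply: subset_trans cC; exact: closureS. Qed.

Lemma interior_open_sub A U : open U -> U `<=` A -> U `<=` A°.
Proof. by move=> oU; rewrite open_subsetE. Qed.

Definition tail S n := closure (\bigcup_(k in [set k | (n <= k)%N]) S k).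

(** Both limit sets have this form, for the sequences of forward images and of
    preimages respectively, and share the topology of it. *)
Definition limsup_set S := \bigcap_n tail S n.

Lemma limsup_set_closed S : closed (limsup_set S).
Proof. by apply: closed_bigI => n _; exact: closed_closure. Qed.

Lemma tail_le S m n : (m <= n)%N -> tail S n `<=` tail S m.
Proof.
move=> mn; apply: closureS => x [k /= nk Sx].
by exists k => //=; exact: leq_trans nk.
Qed.

Lemma limsup_set_sub S C N :
  closed C -> (forall k, (N <= k)%N -> S k `<=` C) -> limsup_set S `<=` C.
Proof.
move=> cC SC x /(_ N I); apply: closure_sub => //.
by move=> y [k /= Nk]; exact: SC.
Qed.

Lemma limsup_set_le S S' : (forall k, S k `<=` closure (S' k)) ->
  limsup_set S `<=` limsup_set S'.
Proof.
move=> SS' x Sx n _; move: (Sx n I); apply: closure_sub => [|y [k nk /SS']].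
  exact: closed_closure.
by apply: closureS => z S'z; exists k.
Qed.

Lemma limsup_setU S S' :
  limsup_set (fun k => S k `|` S' k) = limsup_set S `|` limsup_set S'.
Proof.
apply/seteqP; split; last first.
  by rewrite subUset; split; apply: limsup_set_le => k x Sx;
    apply: subset_closure; [left|right].
move=> x SS'x; apply: contrapT => /not_orP[/existsNP[m nm] /existsNP[n nn]].
have /not_implyP[_ Sm] := nm; have /not_implyP[_ S'n] := nn.
have : (tail S m `|` tail S' n) x.
  rewrite /tail -closureU; move: (SS'x (maxn m n) I); apply: closureS.
  move=> y [k /=]; rewrite geq_max => /andP[mk nk] [Sy|S'y].
    by left; exists k.
  by right; exists k.
by case.
Qed.

Hypothesis compactX : compact [set: X].

(** Compactness enters here: the tails are closed and decrease, so some tail is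
    already inside an open set that contains their intersection. *)
Lemma limsup_set_trap S U : open U -> limsup_set S `<=` U ->
  exists N, tail S N `<=` U.
Proof.
move=> oU SU.
have /compact_near_coveringP/(_ nat \oo) := compactX.
move=> /(_ (fun n x => tail S n x -> U x) _) [|N _ NU]; last first.
  by exists N => x; exact: (NU N (leqnn N) x I).
move=> x _; have [Ux|nUx] := pselect (U x).
  exists (U, setT) => /=; last by move=> [y i] [].
  by split; [exact: open_nbhs_nbhs|exact: filterT].
have /existsNP[n /not_implyP[_ nx]] : ~ limsup_set S x by move/SU.
exists (~` tail S n, [set i | (n <= i)%N]) => /=.
  split; last exact: nbhs_infty_ge.
  by apply: open_nbhs_nbhs; split=> //; apply/closed_openC/closed_closure.
by move=> [y i] [/= ny ni] /(tail_le ni).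
Qed.

Lemma limsup_set_neq0 S : (forall k, S k !=set0) -> limsup_set S !=set0.
Proof.
move=> S0; apply: contrapT => /set0P/negP; rewrite negbK => /eqP S00.
have [|N /(_ _ _)N0] := @limsup_set_trap S set0 open0; first by rewrite S00.
have [x Sx] := S0 N; apply: (N0 x); apply: subset_closure.
by exists N => /=.
Qed.

Variables (f : X -> X).
Hypothesis contf : continuous f.

(** The largest forward invariant subset of [U]. *)
Definition stay U : set X := [set x | forall k, U (iter k f x)].

Lemma iter_continuous k : continuous (iter k f).
Proof.
elim: k => [|k IHk] x; first exact: cvg_id.
by apply: (@continuous_comp _ _ _ (iter k f) f); [exact: IHk|exact: contf].
Qed.

Lemma omega_iter N U V : iter N f @` U `<=` V -> omega f U `<=` omega f V.
Proof.
move=> NUV y yU n _; move: (yU (n + N)%N I); apply: closureS.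
move=> z [k /= nNk [x Ux <-]]; exists (k - N)%N => /=.
  by rewrite leq_subRL ?(leq_trans _ nNk)// ?leq_addl// addnC.
exists (iter N f x); first by apply: NUV; exists x.
by rewrite -iterD subnK// (leq_trans _ nNk)// leq_addl.
Qed.

Lemma omega_closure U : omega f (closure U) = omega f U.
Proof.
apply/seteqP; split; last first.
  by apply: (@omega_iter 0) => _ [x Ux <-]; exact: subset_closure.
apply: limsup_set_le => k _ [x Ux <-] B.
move=> /(@iter_continuous k x _) /Ux[z [Uz Bz]]; by exists (iter k f z).
Qed.

Lemma omega_forward U : f @` omega f U `<=` omega f U.
Proof.
move=> _ [x Ux <-] n _.
move: (Ux n I); set D := closure _.
suff : D `<=` f @^-1` D by exact.
apply: closure_sub.
  by apply: (continuous_closedP f).1 => //; exact: closed_closure.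
move=> y [k /= nk [z Uz <-]]; apply: subset_closure; exists k.+1 => /=.
  exact: leqW.
by exists z.
Qed.

Hypothesis hausX : hausdorff_space X.

(** For the inclusion from right to left: if [y] were not in the image of the
    limit set, the limit set, hence some tail, would miss the preimage of [y];
    but the image of that tail is compact, hence closed, and contains the next
    images of [U], so it contains their limit point [y]. *)
Lemma omega_image U : f @` omega f U = omega f U.
Proof.
apply/seteqP; split; first exact: omega_forward.
move=> y Uy; apply: contrapT => nfy.
have oy : open (f @^-1` ~` [set y]).
  apply: (continuousP f).1 => //; apply: closed_openC.
  by apply: accessible_closed_set1; exact: hausdorff_accessible.
have [|N Ny] := limsup_set_trap oy (S := fun k => iter k f @` U).
  by move=> x Ux fxy; apply: nfy; exists x.
have : (f @` tail (fun k => iter k f @` U) N) y.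
  apply: (@limsup_set_sub (fun k => iter k f @` U) _ N.+1) Uy.
    apply: compact_closed => //; apply: continuous_compact.
      exact: continuous_subspaceT.
    by apply: subclosed_compact compactX _ => //; exact: closed_closure.
  (* The bound [N.+1] leaves one iterate of [f] outside the tail. *)
  move=> [//|k] Nk _ [x Ux <-]; exists (iter k f x) => //.
  by apply: subset_closure; exists k => //; exists x.
by move=> [x /Ny fx].
Qed.

Lemma omega_iter_image N U : iter N f @` omega f U = omega f U.
Proof.
elim: N => [|N IHN].
  by apply/seteqP; split=> [_ [x Ux <-]|x Ux] //; exists x.
rewrite -[RHS]omega_image -[in RHS]IHN; apply/seteqP; split=> y.
  by move=> [x Ux <-]; exists (iter N f x) => //; exists x.
by move=> [_ [x Ux <-] <-]; exists x.
Qed.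

Lemma omega_core : core_operator (omega f).
Proof.
split=> [A B AB|A].
- by apply: (@omega_iter 0) => _ [x Ax <-]; exact: AB.
- apply/seteqP; split.
    apply: (@limsup_set_sub _ _ 0); first exact: limsup_set_closed.
    by move=> k _ x; rewrite omega_iter_image.
  move=> x Ax n _; apply: subset_closure; exists n => //=.
  by have : (iter n f @` omega f A) x by rewrite omega_iter_image.
Qed.

Lemma omegaU A B : omega f (A `|` B) = omega f A `|` omega f B.
Proof.
rewrite /omega -[RHS]limsup_setU; apply: eq_bigcapr => n _.
by congr closure; apply: eq_bigcupr => k _; rewrite image_setU.
Qed.

Let wmono := core_mono omega_core.

Lemma omega0 : omega f set0 = set0.
Proof.
apply/seteqP; split=> // x /(_ 0%N I).
by rewrite bigcup0 ?closure0// => k _; rewrite image_set0.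
Qed.

Lemma alphaS U V : U `<=` V -> alpha f U `<=` alpha f V.
Proof.
by move=> UV; apply: limsup_set_le => k x /UV Vx; apply: subset_closure.
Qed.

Lemma alphaU U V : alpha f (U `|` V) = alpha f U `|` alpha f V.
Proof. exact: (limsup_setU (fun k => iter k f @^-1` U)). Qed.

Lemma alpha0 : alpha f set0 = set0.
Proof.
by apply/seteqP; split=> // x /(_ 0%N I); rewrite bigcup0 ?closure0.
Qed.

Lemma alpha_forward U x : alpha f U x -> alpha f U (f x).
Proof.
move=> Ux n _; move: (Ux n.+1 I); apply: (@closure_sub _ (f @^-1` closure _)).
  by apply: (continuous_closedP f).1 => //; exact: closed_closure.
move=> y [[//|k] nk Uy]; apply: subset_closure; exists k => //.
by move: Uy; rewrite /preimage /= -iterS iterSr.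
Qed.

Lemma stay_sub_alpha U : stay U `<=` alpha f U.
Proof.
by move=> x Ux n _; apply: subset_closure; exists n => //=; exact: Ux.
Qed.

(** Alpha-limit sets are forward invariant by continuity, so once inside [U]
    they stay there; conversely a point that stays in [U] lies in every
    preimage of [U]. This turns questions on repellers into elementary set
    theory. *)
Lemma alpha_stay U : repelling_nbhd f U -> alpha f U = stay U.
Proof.
move=> rU; apply/seteqP; split; last exact: stay_sub_alpha.
move=> x Ux k; apply: interior_subset; apply: rU.
by elim: k => // k IHk; rewrite iterS; exact: alpha_forward.
Qed.

Lemma stay_sub U V : stay U `<=` V -> stay U `<=` stay V.
Proof.
by move=> UV x Ux k; apply: UV => j; rewrite -iterD; exact: Ux.
Qed.

Lemma repellingI U V :
  repelling_nbhd f U -> repelling_nbhd f V -> repelling_nbhd f (U `&` V).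
Proof.
move=> rU rV; rewrite /repelling_nbhd interiorI subsetI.
by split; [apply: subset_trans rU|apply: subset_trans rV];
  apply: alphaS => x [].
Qed.

Lemma alphaI U V : repelling_nbhd f U -> repelling_nbhd f V ->
  alpha f (U `&` V) = alpha f U `&` alpha f V.
Proof.
move=> rU rV; rewrite !alpha_stay//; last exact: repellingI.
by apply/seteqP; split=> [x Hx|x [Ux Vx] k]; [split=> k; have [] := Hx k|split].
Qed.

(** The counterpart of [core_squeeze] for repelling neighborhoods. *)
Lemma alpha_between U V :
  repelling_nbhd f U -> alpha f U `<=` V -> V `<=` U -> alpha f V = alpha f U.
Proof.
move=> rU UV VU; apply/seteqP; split; first exact: alphaS.
rewrite alpha_stay// in UV *.
exact: subset_trans (stay_sub UV) (@stay_sub_alpha V).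
Qed.

Lemma attracting_trap U : attracting_nbhd f U ->
  exists N, forall k x, (N <= k)%N -> closure U x -> U° (iter k f x).
Proof.
rewrite /attracting_nbhd -omega_closure => aU.
have [N NU] := limsup_set_trap (open_interior U) aU.
exists N => k x Nk Ux; apply: NU; apply: subset_closure.
by exists k => //; exists x.
Qed.

(** A point of the closure of [U] is sent by some iterate into the interior of
    [U]; a whole neighborhood of it follows and is later caught in [U] for
    ever, so it eventually misses the preimages of the complement. *)
Lemma attracting_setC U : attracting_nbhd f U -> repelling_nbhd f (~` U).
Proof.
move=> /attracting_trap[N NU]; rewrite /repelling_nbhd interiorC => x xU Ux.
have oW : open (iter N f @^-1` U°).
  apply: (continuousP (iter N f)).1; first exact: iter_continuous.
  exact: open_interior.
(* [N] steps to enter the interior of [U], and [N] more to be caught in it. *)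
have [|z [[k /= Nk nUz] Wz]] := xU (N + N)%N I (iter N f @^-1` U°).
  by apply: open_nbhs_nbhs; split=> //; exact: NU.
apply: nUz; rewrite -[k](@subnK N) ?(leq_trans _ Nk) ?leq_addr// iterD.
apply: interior_subset; apply: NU.
  by rewrite leq_subRL// (leq_trans _ Nk) ?leq_addr.
by apply: subset_closure; exact: interior_subset.
Qed.

Lemma attracting_interior U : attracting_nbhd f U ->
  attracting_nbhd f U° /\ omega f U° = omega f U.
Proof.
move=> aU; have e : omega f U° = omega f U.
  by apply: core_squeeze omega_core _ _ aU _; exact: interior_subset.
split=> //; rewrite /attracting_nbhd e.
by rewrite (interior_id _).1//; exact: open_interior.
Qed.

Lemma attractingI U V :
  attracting_nbhd f U -> attracting_nbhd f V -> attracting_nbhd f (U `&` V).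
Proof.
move=> aU aV; rewrite /attracting_nbhd interiorI subsetI.
by split; [apply: subset_trans aU|apply: subset_trans aV]; apply: wmono => x [].
Qed.

Lemma attractingU U V :
  attracting_nbhd f U -> attracting_nbhd f V -> attracting_nbhd f (U `|` V).
Proof.
move=> aU aV; rewrite /attracting_nbhd omegaU.
by apply: subset_trans (@interiorU _ _ _); exact: setUSS.
Qed.

Lemma repellingU U V :
  repelling_nbhd f U -> repelling_nbhd f V -> repelling_nbhd f (U `|` V).
Proof.
move=> aU aV; rewrite /repelling_nbhd alphaU.
by apply: subset_trans (@interiorU _ _ _); exact: setUSS.
Qed.

(** A point whose orbit meets [U] has its nonempty limit set inside that of
    [U]; one whose orbit avoids [U] has a limit set that avoids the interior of
    [U], where the attractor lies. So the dual repeller consists of the points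
    whose orbits stay outside [U]. *)
Lemma dual_repeller_omega U : attracting_nbhd f U ->
  dual_repeller f (omega f U) = alpha f (~` U).
Proof.
move=> aU; rewrite (alpha_stay (attracting_setC aU)).
apply/seteqP; split=> [x Ux k Ukx|x xU].
  have xsub : omega f [set x] `<=` omega f U.
    by apply: (@omega_iter k) => _ [_ -> <-].
  have [k'|y xy] := @limsup_set_neq0 (fun k => iter k f @` [set x]).
    by exists (iter k' f x), x.
  have : (omega f [set x] `&` omega f U) y by split=> //; exact: xsub.
  by rewrite Ux.
apply/seteqP; split=> // y [xy /aU].
suff : (~` U°) y by [].
apply: (@limsup_set_sub (fun k => iter k f @` [set x]) _ 0) xy.
  exact/open_closedC/open_interior.
by move=> k _ _ [_ -> <-] /interior_subset; exact: xU.
Qed.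

(** The complement of a repelling neighborhood can fail to be attracting: if
    [f] is constant with value a non-isolated point [p], the complement of [p]
    is repelling, but the singleton [p] has empty interior. The complement of a
    tail of preimages of [V] is a larger open set with the same limit, and it
    is attracting. *)
Lemma repelling_dual V : repelling_nbhd f V -> exists2 U,
  attracting_nbhd f U & [/\ closure (~` V) `<=` U, omega f U `<=` ~` V,
    omega f U = omega f (~` V) & alpha f (~` U) = alpha f V].
Proof.
move=> rV; have [N NV] := limsup_set_trap (open_interior V) rV.
set S := tail _ N in NV; pose U := ~` S.
have oU : open U by apply: closed_openC; exact: closed_closure.
have VU : closure (~` V) `<=` U by rewrite closure_setC => x nVx /NV.
have UV k x : (N <= k)%N -> U x -> ~ V (iter k f x).
  by move=> Nk Ux Vx; apply: Ux; apply: subset_closure; exists k.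
have wU : omega f U `<=` closure (~` V).
  apply: (@limsup_set_sub _ _ N); first exact: closed_closure.
  by move=> k Nk _ [x Ux <-]; apply: subset_closure; exact: UV.
have aU : attracting_nbhd f U.
  by rewrite /attracting_nbhd (interior_id _).1//; exact: subset_trans VU.
exists U => //; split=> //.
- by rewrite -(omega_iter_image N) => _ [x /wU/VU Ux <-]; exact: UV.
- apply/seteqP; split.
    by apply: (@omega_iter N) => _ [x Ux <-]; exact: UV.
  by apply: wmono; apply: subset_trans VU; exact: subset_closure.
- rewrite setCK; apply: alpha_between => //; last first.
    by move=> x /NV; exact: interior_subset.
  by move=> x /(_ N I).
Qed.

(** The attractor of [U] is disjoint from the repeller outside [W]; by
    compactness it is disjoint from some preimage of the complement of [W], so
    an iterate maps it, being invariant, into [W]. *)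
Lemma dual_repeller_inj U W : attracting_nbhd f U -> attracting_nbhd f W ->
  alpha f (~` W) `<=` alpha f (~` U) -> omega f U `<=` omega f W.
Proof.
move=> aU aW; rewrite [in X in _ `<=` X](alpha_stay (attracting_setC aU)) => WU.
have oU : open (~` omega f U) by apply: closed_openC; exact: limsup_set_closed.
have [|N NU] := limsup_set_trap oU (S := fun k => iter k f @^-1` (~` W)).
  by move=> x /WU/(_ 0%N) /= nUx /aU /interior_subset.
rewrite -(core_idem omega_core U); apply: (@omega_iter N) => _ [x Ux <-].
apply: contrapT => nW; apply: (NU x) => //; apply: subset_closure.
by exists N => /=.
Qed.

End Topology.

(** * Regular closed sets *)

Section RegularClosed.
Variable X : topologicalType.
Implicit Types (A B P U V : set X).

Lemma regclosed_closed A : regclosed A -> closed A.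
Proof. by move=> <-; exact: closed_closure. Qed.

Lemma regclosed0 : regclosed (@set0 X).
Proof. by rewrite /regclosed interior0 closure0. Qed.

Lemma regclosedT : regclosed [set: X].
Proof. by rewrite /regclosed interiorT closureT. Qed.

Lemma closure_interior_core : core_operator (fun A => closure A°).
Proof.
split=> A; last exact: closure_interior_idem.
by move=> B AB; exact/closureS/interiorS.
Qed.

(** Regularization is not additive on all sets, but it is on closed ones: an
    open part of [A `|` B] that avoids [B] is an open part of [A], and what
    then remains away from the closed interior of [A] is an open part of [B]. *)
Lemma closure_interiorU A B : closed A -> closed B ->
  closure (A `|` B)° = closure A° `|` closure B°.
Proof.
move=> cA cB; rewrite -closureU; apply/seteqP.
split; last by apply: closureS; exact: interiorU.
suff AB' : (A `|` B)° `<=` closure A° `|` B°.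
  apply: closure_sub; first exact: closed_closure.
  apply: subset_trans AB' _; rewrite closureU.
  by apply: setUS; exact: subset_closure.
have AB : (A `|` B)° `<=` A° `|` B.
  move=> x ABx; have [Bx|nBx] := pselect (B x); [by right|left].
  have oW : open ((A `|` B)° `&` ~` B).
    by apply: openI; [exact: open_interior|exact: closed_openC].
  apply: (interior_open_sub oW) => // y [/interior_subset[//|By] nBy].
  by have := nBy By.
move=> x ABx; have [Ax|nAx] := pselect (closure A° x); [by left|right].
have oW : open ((A `|` B)° `&` ~` closure A°).
  apply: openI; [exact: open_interior|apply: closed_openC].
  exact: closed_closure.
apply: (interior_open_sub oW) => // y [/AB[Ay|//] nAy].
by have := nAy (subset_closure Ay).
Qed.

Lemma regclosedU A B : regclosed A -> regclosed B -> regclosed (A `|` B).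
Proof.
move=> rA rB; rewrite /regclosed closure_interiorU; first by rewrite rA rB.
  exact: regclosed_closed.
exact: regclosed_closed.
Qed.

Lemma regclosed_meet_regclosed A B : regclosed (regclosed_meet A B).
Proof. by apply: closure_open_regclosed; exact: open_interior. Qed.

Lemma regclosed_meet_sub A B :
  closed A -> closed B -> regclosed_meet A B `<=` A `&` B.
Proof.
by move=> cA cB; apply: closure_sub; [exact: closedI|exact: interior_subset].
Qed.

Lemma sub_interior_meet A B : (A `&` B)° `<=` (regclosed_meet A B)°.
Proof.
by apply: interior_open_sub; [exact: open_interior|exact: subset_closure].
Qed.

(** Regularization is a core operator and its fixed points are the regular
    closed sets, so their lattice is of the same kind as that of the
    attractors. *)
Lemma regclosed_lattice (C : set (set X)) : C `<=` @regclosed X ->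
    setU_closed C -> (forall A B, C A -> C B -> C (regclosed_meet A B)) ->
    C set0 -> C setT ->
  bounded_distributive_lattice
    (SetLattice C setU (@regclosed_meet X) set0 setT).
Proof.
move=> Cr CU CI C0 CT.
have -> : [set: X] = closure [set: X]° by rewrite interiorT closureT.
apply: (core_lattice closure_interior_core) => //; last first.
  move=> A B D /Cr/regclosed_closed cA /Cr/regclosed_closed cB.
  by move=> /Cr/regclosed_closed cD; apply: closure_interiorU; exact: closedI.
by rewrite interiorT closureT.
Qed.

Lemma regclosed_compl_regclosed A : closed A -> regclosed (regclosed_compl A).
Proof. by move=> cA; apply: closure_open_regclosed; exact: closed_openC. Qed.

Lemma regclosed_complK A : regclosed A ->
  regclosed_compl (regclosed_compl A) = A.
Proof.
by move=> rA; rewrite /regclosed_compl !closure_setC interiorC setCK rA.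
Qed.

Lemma interior_regclosed_compl A : regclosed A -> (regclosed_compl A)° = ~` A.
Proof. by move=> rA; rewrite /regclosed_compl closure_setC interiorC rA. Qed.

Lemma regclosed_complU A B : regclosed A -> regclosed B ->
  regclosed_compl (A `|` B) =
  regclosed_meet (regclosed_compl A) (regclosed_compl B).
Proof.
move=> rA rB; rewrite /regclosed_meet interiorI !interior_regclosed_compl//.
by rewrite -setCU.
Qed.

Lemma regclosed_complI A B : regclosed A -> regclosed B ->
  regclosed_compl (regclosed_meet A B) =
  regclosed_compl A `|` regclosed_compl B.
Proof.
move=> rA rB; rewrite /regclosed_compl /regclosed_meet !closure_setC.
rewrite interior_closed_regopen ?interiorI ?setCI//.
by apply: closedI; exact: regclosed_closed.
Qed.

End RegularClosed.

(** * Evaluation on a grid *)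

Section Grid.
Variables (X : topologicalType) (E : finType) (cell : E -> set X).
Hypothesis gridE : is_grid cell.
Implicit Types (U V : set E).

Lemma gevalT : geval cell setT = setT.
Proof. exact: grid_cover gridE. Qed.

Lemma geval_cover U : ~` geval cell U `<=` geval cell (~` U).
Proof.
move=> x nUx; have : geval cell setT x by rewrite gevalT.
by move=> [xi _ xx]; exists xi => // Uxi; apply: nUx; exists xi.
Qed.

Lemma geval_sub U V : U `<=` V -> geval cell U `<=` geval cell V.
Proof. by move=> UV x [xi /UV Vxi xxi]; exists xi. Qed.

Lemma geval_closed U : closed (geval cell U).
Proof.
apply: closed_bigcup; first exact: finite_finset.
by move=> xi _; apply: regclosed_closed; exact: grid_regclosed.
Qed.

Lemma geval_regclosed U : regclosed (geval cell U).
Proof.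
apply/seteqP; split.
  by apply: closure_sub; [exact: geval_closed|exact: interior_subset].
move=> x [xi Uxi]; rewrite -(grid_regclosed gridE xi).
by apply: closureS; apply: interiorS => y xy; exists xi.
Qed.

(** An interior point of the cells of [U] is in no other cell: being regular
    closed, such a cell would have interior points nearby that belong to a cell
    of [U], against the disjointness of the grid. *)
Lemma interior_geval U : (geval cell U)° = ~` geval cell (~` U).
Proof.
apply/seteqP; split; last first.
  apply: interior_open_sub; first by apply: closed_openC; exact: geval_closed.
  by rewrite -[X in _ `<=` geval cell X]setCK; exact: geval_cover.
move=> x Ux [eta nUeta]; rewrite -(grid_regclosed gridE eta).
move=> /(_ _ (nbhs_interior Ux))[y [yeta /interior_subset[xi Uxi yxi]]].
have xieta : xi != eta by apply/eqP => e; apply: nUeta; rewrite -e.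
have : (cell xi `&` (cell eta)°) y by [].
by rewrite (grid_disjoint gridE xieta).
Qed.

Lemma geval_setC U : geval cell (~` U) = regclosed_compl (geval cell U).
Proof. by rewrite /regclosed_compl closure_setC interior_geval setCK. Qed.

Lemma gevalI U V :
  geval cell (U `&` V) = regclosed_meet (geval cell U) (geval cell V).
Proof.
rewrite -[LHS](geval_regclosed _) /regclosed_meet interiorI !interior_geval.
by rewrite setCI /geval bigcup_setU setCU.
Qed.

Lemma geval_le U V : geval cell U `<=` geval cell V -> U `<=` V.
Proof.
move=> UV xi Uxi; apply: contrapT => nVxi.
have [x xxi] := grid_nonempty gridE xi.
move: xxi; rewrite -(grid_regclosed gridE xi).
move=> /(_ setT filterT)[y [yxi _]].
have : (geval cell V)° y.
  by move: yxi; apply: interiorS => z zxi; apply: UV; exists xi.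
by rewrite interior_geval; apply; exists xi => //; exact: interior_subset.
Qed.

Lemma geval_inj U V : geval cell U = geval cell V -> U = V.
Proof.
by move=> UV; apply/seteqP; split; apply: geval_le; rewrite UV.
Qed.

Lemma geval_mono (C : set (set E)) (D : set (set X)) :
    (forall U, C U -> D (geval cell U)) ->
  lattice_mono (SetLattice C setU setI set0 setT)
    (SetLattice D setU (@regclosed_meet X) set0 setT) (geval cell).
Proof.
move=> CD; split; last by move=> U V _ _; exact: geval_inj.
split=> /= [U|U V _ _|U V _ _||].
- exact: CD.
- exact: bigcup_setU.
- exact: gevalI.
- exact: bigcup_set0.
- exact: gevalT.
Qed.

Variables (f : X -> X) (F : E -> set E).
Hypothesis outerF : outer_approximation f cell F.

Lemma outer_step U : f @` geval cell U `<=` (geval cell (mv_image F U))°.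
Proof.
move=> _ [x [xi Uxi xxi] <-].
have : (geval cell (F xi))° (f x) by apply: outerF; exists x.
by apply: interiorS; apply: geval_sub => eta; exists xi.
Qed.

Lemma outer_iter n xi x : cell xi x -> geval cell (mv_pow F n xi) (iter n f x).
Proof.
move=> xxi; elim: n => [|n IHn]; first by exists xi.
apply: interior_subset; have := @outer_step (mv_pow F n xi) (iter n.+1 f x).
by apply; exists (iter n f x).
Qed.
End Grid.

(** * The diagram of neighborhoods, attractors and repellers *)

Section Dynamics.
Variables (X : topologicalType) (f : X -> X).
Hypotheses (compactX : compact [set: X]) (hausX : hausdorff_space X).
Hypothesis (contf : continuous f).
Implicit Types (A B U V : set X).

Let oP : core_operator (omega f) := omega_core compactX contf hausX.

Lemma ANbhd_lattice : bounded_distributive_lattice (ANbhd f).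
Proof.
apply: regclosed_lattice => [U []//|A B [rA aA] [rB aB]|A B [rA aA] [rB aB]||].
- by split; [exact: regclosedU|exact: attractingU].
- split; first exact: regclosed_meet_regclosed.
  apply: subset_trans (@sub_interior_meet _ A B).
  apply: subset_trans (attractingI compactX contf hausX aA aB).
  by apply: (core_mono oP); apply: regclosed_meet_sub; exact: regclosed_closed.
- by split; [exact: regclosed0|rewrite /attracting_nbhd omega0].
- by split; [exact: regclosedT|rewrite /attracting_nbhd interiorT].
Qed.

Lemma RNbhd_lattice : bounded_distributive_lattice (RNbhd f).
Proof.
apply: regclosed_lattice => [U []//|A B [rA aA] [rB aB]|A B [rA aA] [rB aB]||].
- by split; [exact: regclosedU|exact: repellingU].
- split; first exact: regclosed_meet_regclosed.
  apply: subset_trans (@sub_interior_meet _ A B).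
  apply: subset_trans (repellingI aA aB).
  by apply: alphaS; apply: regclosed_meet_sub; exact: regclosed_closed.
- by split; [exact: regclosed0|rewrite /repelling_nbhd alpha0].
- by split; [exact: regclosedT|rewrite /repelling_nbhd interiorT].
Qed.

Lemma omega_meet U V : attracting_nbhd f U -> attracting_nbhd f V ->
  omega f (U `&` V) = omega f (omega f U `&` omega f V).
Proof.
move=> aU aV; apply: (core_meet oP) => //.
by move=> x [/aU/interior_subset ? /aV/interior_subset].
Qed.

Lemma Att_lattice : bounded_distributive_lattice (Att f).
Proof.
apply: (core_lattice oP) => [_ [U _ ->]|_ _ [U aU ->] [V aV ->]|
  _ _ [U aU ->] [V aV ->]|||A B D _ _ _].
- exact: core_idem.
- by exists (U `|` V); [exact: attractingU|rewrite omegaU].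
- by exists (U `&` V); [exact: attractingI|rewrite (@omega_meet U V)].
- by exists set0; rewrite /attracting_nbhd ?omega0.
- by exists setT; rewrite /attracting_nbhd ?interiorT.
- exact: omegaU.
Qed.

Lemma alphaT : alpha f setT = setT.
Proof. by apply/seteqP; split=> // x _; exact: stay_sub_alpha. Qed.

Lemma Rep_lattice : bounded_distributive_lattice (Rep f).
Proof.
apply: set_ring_lattice => [_ _ [U aU ->] [V aV ->]|_ _ [U aU ->] [V aV ->]||].
- by exists (U `|` V); [exact: repellingU|rewrite alphaU].
- by exists (U `&` V); [exact: repellingI|rewrite alphaI].
- by exists set0; rewrite /repelling_nbhd alpha0.
- by exists setT; rewrite /repelling_nbhd ?interiorT ?alphaT.
Qed.

(** An attracting neighborhood is brought into regular closed form by taking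
    the closure of its interior, which changes neither its limit set nor the
    fact that it attracts. *)
Lemma omega_epi : lattice_epi (ANbhd f) (Att f) (omega f).
Proof.
split.
  split=> //= [U [_ aU]|U V _ _|U V [rU aU] [rV aV]|].
  - by exists U.
  - exact: omegaU.
  - apply: (core_meet oP).
      move=> x [/aU Ux /aV Vx]; apply: subset_closure.
      by rewrite interiorI.
    by apply: regclosed_meet_sub; exact: regclosed_closed.
  - exact: omega0.
move=> _ [U aU ->]; have [aU' e] := attracting_interior compactX contf hausX aU.
exists (closure U°); last by rewrite omega_closure.
split; first by apply: closure_open_regclosed; exact: open_interior.
rewrite /attracting_nbhd omega_closure// e; apply: subset_trans aU _.
by apply: interior_open_sub; [exact: open_interior|exact: subset_closure].
Qed.

Lemma regclosed_compl_repelling U :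
  carrier (ANbhd f) U -> carrier (RNbhd f) (regclosed_compl U).
Proof.
move=> [rU aU]; split.
  by apply: regclosed_compl_regclosed; exact: regclosed_closed.
have [aU' _] := attracting_interior compactX contf hausX aU.
by rewrite /regclosed_compl closure_setC; exact: attracting_setC.
Qed.

Lemma regclosed_compl_attracting U :
  carrier (RNbhd f) U -> carrier (ANbhd f) (regclosed_compl U).
Proof.
move=> [rU aU]; split.
  by apply: regclosed_compl_regclosed; exact: regclosed_closed.
have [V _ [UV VU _ _]] := repelling_dual compactX contf hausX aU.
rewrite /attracting_nbhd interior_regclosed_compl//.
by apply: subset_trans VU; exact: (core_mono oP).
Qed.

Lemma alpha_regclosed_compl U : attracting_nbhd f U ->
  alpha f (regclosed_compl U) = dual_repeller f (omega f U).
Proof.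
move=> aU; have [aU' <-] := attracting_interior compactX contf hausX aU.
by rewrite /regclosed_compl closure_setC dual_repeller_omega.
Qed.

(** Preimages do not commute with closures, so a repelling neighborhood cannot
    be regularized directly; a regular closed one is obtained as the complement
    of a regular closed neighborhood of the dual attractor. *)
Lemma alpha_epi : lattice_epi (RNbhd f) (Rep f) (alpha f).
Proof.
split.
  split=> //= [U [_ aU]|U V _ _|U V [rU aU] [rV aV]||].
  - by exists U.
  - exact: alphaU.
  - rewrite -alphaI//; apply: (alpha_between contf (repellingI aU aV)).
      by apply: subset_trans (repellingI aU aV) _; exact: subset_closure.
    by apply: regclosed_meet_sub; exact: regclosed_closed.
  - exact: alpha0.
  - exact: alphaT.
move=> _ [V rV ->].
have [U aU [_ _ _ <-]] := repelling_dual compactX contf hausX rV.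
have [W AW WU] := omega_epi.2 (omega f U) (ex_intro2 _ _ U aU erefl).
exists (regclosed_compl W); first exact: regclosed_compl_repelling.
have [_ aW] := AW.
by rewrite alpha_regclosed_compl// WU dual_repeller_omega.
Qed.

Lemma regclosed_compl_pair : lattice_anti_iso_pair (ANbhd f) (RNbhd f)
  (@regclosed_compl X) (@regclosed_compl X).
Proof.
apply: anti_iso_pair.
- exact: bdl_join ANbhd_lattice.
- exact: bdl_meet ANbhd_lattice.
- exact: regclosed_compl_repelling.
- exact: regclosed_compl_attracting.
- by move=> U [rU _]; exact: regclosed_complK.
- by move=> U [rU _]; exact: regclosed_complK.
- by move=> U V [rU _] [rV _]; exact: regclosed_complU.
- by move=> U V [rU _] [rV _]; exact: regclosed_complI.
Qed.

Lemma dual_attractorP B : carrier (Rep f) B -> exists2 U,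
  attracting_nbhd f U & dual_attractor f B = omega f U /\ alpha f (~` U) = B.
Proof.
move=> [V rV BV]; rewrite /dual_attractor.
have [|rW WB] := @xgetPex _ set0 [set V | repelling_nbhd f V /\ alpha f V = B].
  by exists V.
set W := xget _ _ in rW WB *.
have [U aU [_ _ UW aUW]] := repelling_dual compactX contf hausX rW.
by exists U => //; split; [rewrite UW|rewrite aUW].
Qed.

Lemma dual_pair :
  lattice_anti_iso_pair (Att f) (Rep f) (dual_repeller f) (dual_attractor f).
Proof.
have gM A : carrier (Att f) A -> carrier (Rep f) (dual_repeller f A).
  move=> [U aU ->]; rewrite dual_repeller_omega//.
  by exists (~` U) => //; exact: attracting_setC.
apply: anti_iso_pair.
- exact: bdl_join Att_lattice.
- exact: bdl_meet Att_lattice.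
- exact: gM.
- by move=> B /dual_attractorP[U aU [-> _]]; exists U.
- move=> A AA; have [W aW [-> WA]] := dual_attractorP (gM _ AA).
  have [U aU AU] := AA; move: WA; rewrite AU dual_repeller_omega// => WU.
  by apply/seteqP; split; apply: dual_repeller_inj => //; rewrite WU.
- by move=> B /dual_attractorP[U aU [-> <-]]; exact: dual_repeller_omega.
- move=> A B _ _ /=; apply/seteqP; rewrite /dual_repeller.
  by split=> x /=; rewrite setIUr setU_eq0.
- move=> _ _ [U aU ->] [V aV ->] /=; rewrite -omega_meet//.
  rewrite !dual_repeller_omega ?setCI ?alphaU//; exact: attractingI.
Qed.

Variables (E : finType) (cell : E -> set X) (F : E -> set E).
Hypotheses (gridE : is_grid cell) (outerF : outer_approximation f cell F).

(** By [mv_omega_absorbs] all late images of [geval cell U] are covered by the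
    cells of the combinatorial limit, a closed set. *)
Lemma omega_geval_sub (U : set E) :
  omega f (geval cell U) `<=` geval cell (mv_omega F U).
Proof.
have [K KU] := mv_omega_absorbs F U.
apply: (@limsup_set_sub _ _ _ K); first exact: geval_closed.
move=> n Kn _ [x [xi Uxi xxi] <-].
have [eta xieta etax] := outer_iter outerF n xxi.
by exists eta => //; apply: KU xieta.
Qed.

(** Both limit sets are invariant, and one step of an outer approximation gains
    an interior. *)
Lemma omega_geval_interior (U : set E) :
  omega f (geval cell U) `<=` (geval cell (mv_omega F U))°.
Proof.
rewrite -omega_image// -[in X in _ `<=` X]mv_omega_fixed.
apply: subset_trans (outer_step outerF (U := mv_omega F U)).
by apply: image_subset; exact: omega_geval_sub.
Qed.

Lemma geval_attracting (U : set E) :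
  carrier (ASet F) U -> carrier (ANbhd f) (geval cell U).
Proof.
move=> AU; split; first exact: geval_regclosed.
apply: subset_trans (@omega_geval_interior U) _.
by apply: interiorS; exact: geval_sub.
Qed.

Lemma geval_repelling (U : set E) :
  carrier (RSet F) U -> carrier (RNbhd f) (geval cell U).
Proof.
move=> /ASet_setC/geval_attracting/regclosed_compl_repelling.
by rewrite -geval_setC// setCK.
Qed.

Lemma omega_geval_mv_omega (U : set E) : carrier (ASet F) U ->
  omega f (geval cell (mv_omega F U)) = omega f (geval cell U).
Proof.
move=> AU; apply: (core_squeeze oP); first exact: omega_geval_sub.
exact: geval_sub.
Qed.

(** If a point stays in [geval cell U] but lies in a cell outside the backward
    limit of [U], the paths from this cell are eventually outside [U], so the
    orbit ends up in the interior of the cells outside [U]. *)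
Lemma alpha_geval_mv_alpha (U : set E) : carrier (RSet F) U ->
  alpha f (geval cell (mv_alpha F U)) = alpha f (geval cell U).
Proof.
move=> RU; have [_ rU] := geval_repelling RU.
apply: alpha_between => //; last exact: geval_sub.
rewrite alpha_stay// => x xU; apply: contrapT.
move=> /(geval_cover gridE)[xi nxi xxi].
apply: nxi; apply/mv_omegaP => k; exists k.+1 => //.
apply: contrapT => nUk.
have : (geval cell (mv_pow F k.+1 xi))° (iter k.+1 f x).
  apply: (outer_step outerF (U := mv_pow F k xi)).
  by exists (iter k f x) => //; exact: outer_iter.
rewrite interior_geval//; apply; apply: geval_sub (xU k.+1) => y Uy xiy.
by apply: nUk; exists y => //; apply/mv_pow_inv.
Qed.
End Dynamics.

Theorem theorem3p17 (R : realType) (X : metricType R) (f : X -> X)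
    (E : finType) (cell : E -> set X) (F : E -> set E)
    (compactX : compact [set: X]) (contf : continuous f)
    (gridE : is_grid cell) (outerF : outer_approximation f cell F) :
  (* objects: bounded distributive lattices *)
  [/\ [/\ bounded_distributive_lattice (Invset_plus F),
          bounded_distributive_lattice (ASet F),
          bounded_distributive_lattice (mvAtt F),
          bounded_distributive_lattice (ANbhd f) &
          bounded_distributive_lattice (Att f)] &
      [/\ bounded_distributive_lattice (Invset_minus F),
          bounded_distributive_lattice (RSet F),
          bounded_distributive_lattice (mvRep F),
          bounded_distributive_lattice (RNbhd f) &
          bounded_distributive_lattice (Rep f)]] /\
  (* maps *)
  [/\ lattice_mono (Invset_plus F) (ASet F) (@inclusion _) /\
        lattice_mono (Invset_minus F) (RSet F) (@inclusion _),
      [/\ lattice_epi (Invset_plus F) (mvAtt F) (mv_omega F),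
          lattice_epi (ASet F) (mvAtt F) (mv_omega F),
          lattice_epi (Invset_minus F) (mvRep F) (mv_alpha F) &
          lattice_epi (RSet F) (mvRep F) (mv_alpha F)],
      lattice_mono (ASet F) (ANbhd f) (geval cell) /\
        lattice_mono (RSet F) (RNbhd f) (geval cell),
      lattice_epi (ANbhd f) (Att f) (omega f) /\
        lattice_epi (RNbhd f) (Rep f) (alpha f) &
      lattice_hom (mvAtt F) (Att f) (fun A => omega f (geval cell A)) /\
        lattice_hom (mvRep F) (Rep f) (fun A => alpha f (geval cell A))] /\
  (* anti-isomorphisms *)
  [/\ lattice_anti_iso_pair (Invset_plus F) (Invset_minus F) setC setC,
      lattice_anti_iso_pair (ASet F) (RSet F) setC setC,
      lattice_anti_iso_pair (ANbhd f) (RNbhd f)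
        (@regclosed_compl X) (@regclosed_compl X) &
      lattice_anti_iso_pair (Att f) (Rep f)
        (dual_repeller f) (dual_attractor f)] /\
  (* commutativity *)
  [/\ (forall U, carrier (Invset_plus F) U ->
            mv_omega F (inclusion U) = mv_omega F U)
      /\ (forall U, carrier (Invset_minus F) U ->
            mv_alpha F (inclusion U) = mv_alpha F U),
      (forall U, carrier (Invset_plus F) U ->
            inclusion (~` U) = ~` inclusion U)
      /\ (forall U, carrier (Invset_minus F) U ->
            inclusion (~` U) = ~` inclusion U),
      forall U, carrier (ASet F) U ->
        geval cell (~` U) = regclosed_compl (geval cell U),
      forall U, carrier (ANbhd f) U ->
        alpha f (regclosed_compl U) = dual_repeller f (omega f U) &
      (forall U, carrier (ASet F) U ->
         omega f (geval cell (mv_omega F U)) = omega f (geval cell U))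
      /\ (forall U, carrier (RSet F) U ->
            alpha f (geval cell (mv_alpha F U)) = alpha f (geval cell U))].
Proof.
have hX : hausdorff_space X := @metric_hausdorff _ X.
split; first split.
- split; [exact: Invset_lattice|exact: ASet_lattice|exact: mvAtt_lattice|..].
    exact: ANbhd_lattice.
  exact: Att_lattice.
- split; [exact: (Invset_lattice (mv_inv F))|exact: (ASet_lattice (mv_inv F))|
    exact: (mvAtt_lattice (mv_inv F))|..].
    exact: RNbhd_lattice.
  exact: Rep_lattice.
have AN : lattice_mono (ASet F) (ANbhd f) (geval cell).
  apply: geval_mono => // U; exact: geval_attracting.
have RN : lattice_mono (RSet F) (RNbhd f) (geval cell).
  apply: geval_mono => // U; exact: geval_repelling.
have wE := omega_epi compactX hX contf.
have aE := alpha_epi compactX hX contf.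
split; first split.
- split; first exact: Invset_ASet_mono.
  exact: (Invset_ASet_mono (mv_inv F)).
- split; [exact: mv_omega_Invset_epi|exact: mv_omega_ASet_epi|..].
    exact: (mv_omega_Invset_epi (mv_inv F)).
  exact: (mv_omega_ASet_epi (mv_inv F)).
- by [].
- by [].
- split.
    apply: (lattice_hom_factor (ASet_lattice F) (mv_omega_ASet_epi F)
      (lattice_hom_comp AN.1 wE.1)).
    by move=> U; exact: omega_geval_mv_omega.
  apply: (lattice_hom_factor (ASet_lattice (mv_inv F))
    (mv_omega_ASet_epi (mv_inv F)) (lattice_hom_comp RN.1 aE.1)).
  by move=> U; exact: alpha_geval_mv_alpha.
split.
  split; [exact: Invset_compl|exact: ASet_compl|..].
    exact: regclosed_compl_pair.
  exact: dual_pair.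
split=> //.
- by move=> U _; exact: geval_setC.
- by move=> U [_ aU]; exact: alpha_regclosed_compl.
- by split=> U; [exact: omega_geval_mv_omega|exact: alpha_geval_mv_alpha].
Qed.
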